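(* Let $G$ be a plane graph such that every face adjacent to a $3$-face has length at least $5$ and every $5$-face is adjacent to at most three $3$-faces, and suppose $\delta(G)\geq 3$. Then $G$ contains at least one of the following configurations: (H4) an edge both of whose endpoints have degree $3$; (H5) two paths $P_i=v_1v_2^iv_3^i\cdots v_{p_i+2}^i$, $i\in\{1,2\}$, sharing the initial vertex $v_1$, such that each $P_i$ is a $4(p_i)3$-path with $p_i\leq 3$ and $v_2^1\neq v_2^2$; (H6) four paths $P_i=v_1v_2^iv_3^i\cdots v_{p_i+2}^i$, $i\in\{1,2,3,4\}$, sharing the initial vertex $v_1$, such that each $P_i$ is a $5(p_i)3$-path with $p_i\leq 4$, the vertices $v_2^1,v_2^2,v_2^3,v_2^4$ are pairwise distinct, and moreover if some $P_i$ is a $5(4)3$-path then $v_1$ is adjacent to the last vertex $v_{6}^i$ of $P_i$ and the edge $v_1v_6^i$ is itself one of the four paths (a $5(0)3$-path).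
   Context: All graphs are finite and simple; $\delta(G)$ is the minimum degree, degrees are degrees in $G$. In a plane graph, a $k$-face is a face of length $k$ (length = number of edges on its boundary walk, a cut edge counted twice); two faces are adjacent if they share an edge. For positive integers $x,y$ and a non-negative integer $p$, an $x(p)y$-path is a path on $p+2$ vertices whose $p$ internal vertices have degree $4$ and whose endpoints have degrees $x$ (first vertex) and $y$ (last vertex). The paths in (H5) and (H6) may share vertices other than $v_1$. *)

(* Defs.v *)
From HB Require Import structures.
From mathcomp Require Import all_boot.

Set Implicit Arguments.
Unset Strict Implicit.
Unset Printing Implicit Defensive.

Record sgraph := SGraph {
  vertex :> finType;
  adj : rel vertex;
  adj_sym : symmetric adj;
  adj_irr : irreflexive adj }.

Section Graph.
Variable G : sgraph.

Definition deg (v : G) : nat := #|[set u | adj v u]|.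

(* The initial value #|G| exceeds every degree, so it only matters for the
   graph without vertices, whose minimum degree is thus set to 0. *)
Definition min_deg : nat := \big[minn/#|G|]_(v : G) deg v.

Definition edges : {set {set G}} :=
  [set [set u; v] | u in [set: G], v in [set: G] & adj u v].

Definition components : nat := n_comp (@adj G) G.

(* v :: rcons q w is an x(p)y-path; q lists its internal vertices. *)
Definition xpy_path (x p y : nat) (v : G) (q : seq G) (w : G) : Prop :=
  [/\ size q = p,
      uniq (v :: rcons q w) && path (@adj G) v (rcons q w),
      deg v = x, deg w = y & {in q, forall z, deg z = 4}].

Definition second_vertex (q : seq G) (w : G) : G := head w q.

Definition H4 : Prop := exists u v : G, [/\ adj u v, deg u = 3 & deg v = 3].

Definition H5 : Prop :=
  exists (v1 : G) (p : 'I_2 -> nat) (q : 'I_2 -> seq G) (w : 'I_2 -> G),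
    (forall i, xpy_path 4 (p i) 3 v1 (q i) (w i) /\ p i <= 3) /\
    injective (fun i => second_vertex (q i) (w i)).

(* A path v1 :: rcons (q j) (w j) with q j = [::] is the edge v1 w_j. *)
Definition H6 : Prop :=
  exists (v1 : G) (p : 'I_4 -> nat) (q : 'I_4 -> seq G) (w : 'I_4 -> G),
    [/\ forall i, xpy_path 5 (p i) 3 v1 (q i) (w i) /\ p i <= 4,
        injective (fun i => second_vertex (q i) (w i)) &
        forall i, p i = 4 ->
          adj v1 (w i) /\ exists j, q j = [::] /\ w j = w i].

End Graph.

(* Plane graphs, possibly disconnected, as combinatorial maps: [rot v] is the
   cyclic order of the neighbours of v around v, and [side u v] is the face
   lying along the edge uv on the side of the walk that arrives at v from u and
   leaves towards [rot v u].  As the boundary of a face of a disconnected graph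
   consists of several closed walks, a face may carry several orbits of
   (u, v) |-> (v, rot v u).  For an isolated vertex u, [side u u] is the face
   containing u; all other values of [side] and [rot] at non-adjacent
   arguments are irrelevant.

   Let the rotation system have genus g and f0 boundary walks (an isolated
   vertex counting as one), so that V - E + f0 = 2C - 2g with C the number of
   components.  The bipartite multigraph joining components to faces through
   the walks is connected by [plane_connected], hence C + F - f0 <= 1, and
   [plane_Euler] forces both g = 0 and this multigraph to be a tree: these are
   exactly the structures coming from graphs drawn on the sphere. *)
Section Incidence.
Variables (G : sgraph) (F : finType) (side : G -> G -> F).

Definition incident (u : G) (f : F) : bool :=
  [exists v, (adj u v || ((v == u) && (deg u == 0))) && (side u v == f)].

Definition incidence : rel (G + F) := fun x y =>
  match x, y with
  | inl u, inl v => adj u v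
  | inl u, inr f => incident u f
  | inr f, inl u => incident u f
  | inr _, inr _ => false
  end.

End Incidence.

Record plane_graph := PlaneGraph {
  graph :> sgraph;
  face : finType;
  rot : graph -> graph -> graph;
  side : graph -> graph -> face;
  rot_adj : forall v x, adj v x -> adj v (rot v x);
  rot_cyclic : forall v x y, adj v x -> adj v y -> fconnect (rot v) x y;
  side_walk : forall u v, adj u v -> side v (rot v u) = side u v;
  plane_connected : forall x y, connect (incidence side) x y;
  plane_Euler : #|graph| + #|face| = #|edges graph| + components graph + 1 }.

Section Faces.
Variable G : plane_graph.

(* Each edge is counted once for each of its two sides lying along f; a cut
   edge has both sides along the same face, so it is counted twice. *)
Definition face_length (f : face G) : nat :=
  #|[set d : G * G | adj d.1 d.2 && (side d.1 d.2 == f)]|.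

Definition face_adj (f g : face G) : bool :=
  (f != g) &&
  [exists u : G, exists v : G,
     [&& adj u v, side u v == f & side v u == g]].

End Faces.

(* Main.v *)
Require Import Defs.
From HB Require Import structures.
From mathcomp Require Import all_boot zify.

(* Discharging, with all charges multiplied by 3: a vertex v has charge
   3 (deg v - 4) and a face f has charge 3 (length f - 4); by Euler's formula the
   total is negative.  Every 3-face receives 1 through each of its edges.  Every
   3-vertex receives 1 for each of its darts d: follow the boundary of the face
   of d from the 3-vertex to the first vertex u of degree other than 4.  Without
   (H4) and (H5), deg u >= 5 whenever u is at distance at most 4 along the walk,
   and then u pays.  Otherwise the face pays if its length is at least 7; if its
   length is at most 6, the walk goes around a 6-face and u is its last vertex,
   adjacent to the 3-vertex, and u pays.  Distinct darts are served through
   distinct darts of u, so without (H6) a 5-vertex pays at most 3. *)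

Set Implicit Arguments.
Unset Strict Implicit.
Unset Printing Implicit Defensive.

(** * Counting, minimum degree and the paths of (H5) *)

Lemma sum_card_fiber (T I : finType) (P : pred T) (h : T -> I) :
  \sum_i #|[set t | (h t == i) && P t]| = #|[set t | P t]|.
Proof.
rewrite -[RHS]sum1dep_card (partition_big h xpredT) //=.
by apply: eq_bigr => i _; rewrite sum1dep_card; apply: eq_card => t; rewrite !inE andbC.
Qed.

Lemma bigminn_le (I : eqType) (x : nat) (F : I -> nat) (s : seq I) i :
  i \in s -> \big[minn/x]_(j <- s) F j <= F i.
Proof.
elim: s => // j s IH; rewrite big_cons inE geq_min => /predU1P[->|/IH->].
  by rewrite leqnn.
by rewrite orbT.
Qed.

Lemma min_deg_le (G : sgraph) (v : G) : min_deg G <= deg v.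
Proof. by apply: bigminn_le; rewrite mem_index_enum. Qed.

Lemma min_deg_le_card (G : sgraph) : min_deg G <= #|G|.
Proof.
rewrite /min_deg; elim: (index_enum _) => [|v s IH]; first by rewrite big_nil.
by rewrite big_cons geq_min IH orbT.
Qed.

Lemma deg_neq (G : sgraph) (u v : G) : deg u != deg v -> u != v.
Proof. by apply: contraNneq => ->. Qed.

Lemma xpy_path_intro (G : sgraph) (x y : nat) (v : G) q w :
  uniq (v :: rcons q w) && path (@adj G) v (rcons q w) ->
  deg v = x -> deg w = y -> all (fun z => deg z == 4) q ->
  xpy_path x (size q) y v q w.
Proof. by move=> ? ? ? /allP q4; split=> // z /q4/eqP. Qed.

Lemma H5_intro (G : sgraph) (v : G) q1 w1 q2 w2 :
  xpy_path 4 (size q1) 3 v q1 w1 -> size q1 <= 3 ->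
  xpy_path 4 (size q2) 3 v q2 w2 -> size q2 <= 3 ->
  second_vertex q1 w1 != second_vertex q2 w2 -> H5 G.
Proof.
move=> P1 s1 P2 s2 /eqP neq; pose pick T (a b : T) (i : 'I_2) := if i == ord0 then a else b.
exists v, (pick _ (size q1) (size q2)), (pick _ q1 q2), (pick _ w1 w2); split.
  by move=> i; rewrite /pick; case: ifP.
move=> i j; rewrite /pick.
case: (i =P ord0) => [->|/eqP i0]; case: (j =P ord0) => [->|/eqP j0] //.
- by move/esym.
- by move=> _; apply: val_inj; case: i j i0 j0 => [[|[|i]] ?] [[|[|j]] ?].
Qed.

(** * Darts and facial walks *)

Section Darts.
Variable G : plane_graph.

Definition dart : finType := {d : G * G | adj d.1 d.2}.

Definition src (d : dart) : G := (val d).1.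
Definition dst (d : dart) : G := (val d).2.

Definition mkdart (u v : G) (uv : adj u v) : dart :=
  Sub (u, v) (uv : adj (u, v).1 (u, v).2).

Lemma dart_adj (d : dart) : adj (src d) (dst d).
Proof. exact: (valP d). Qed.

Lemma dart_eqP (d e : dart) : src d = src e -> dst d = dst e -> d = e.
Proof.
case: d e => [[a b] ab] [[a' b'] ab']; rewrite /src /dst /= => ea eb.
by apply: val_inj; rewrite /= ea eb.
Qed.

Definition drev (d : dart) : dart :=
  mkdart (etrans (adj_sym (dst d) (src d)) (dart_adj d)).

Definition dnext (d : dart) : dart := mkdart (rot_adj (valP (drev d))).

Definition left_face (d : dart) : face G := side (src d) (dst d).

Lemma drevK : involutive drev.
Proof. by move=> d; apply: dart_eqP. Qed.

Lemma rot_onto (v y : G) : adj v y -> exists2 x, adj v x & Defs.rot v x = y.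
Proof.
(* Starting at [rot v y] instead of [y] makes the return to [y] include at least one further
   rotation, so the last one can be undone. *)
move=> vy; have /iter_findex <- := rot_cyclic (rot_adj vy) vy.
set n := findex _ _ _; exists (iter n (Defs.rot v) y); last by rewrite -iterS -iterSr.
by elim: n => //= n; apply: rot_adj.
Qed.

(** [rot_onto] gives [dnext] a right inverse, which on a finite type is also a left inverse. *)
Lemma dnext_inj : injective dnext.
Proof.
have /fin_all_exists[g gK] : forall d : dart, exists e, dnext e = d.
  move=> d; have [x vx rx] := rot_onto (dart_adj d).
  exists (drev (mkdart vx)); apply: dart_eqP; rewrite /src /dst //=.
exact: can_inj (canF_sym (gK : cancel g dnext)).
Qed.

Lemma iter_dnext_inj n : injective (iter n dnext).
Proof. by elim: n => // n IH d e /= /dnext_inj /IH. Qed.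

Lemma left_face_next (d : dart) : left_face (dnext d) = left_face d.
Proof. by rewrite /left_face /src /dst /= side_walk // dart_adj. Qed.

Lemma left_face_iter n (d : dart) : left_face (iter n dnext d) = left_face d.
Proof. by elim: n => //= n <-; exact: left_face_next. Qed.

Lemma deg_dart (v : G) : deg v = #|[set d : dart | src d == v]|.
Proof.
rewrite /deg -(@card_in_imset _ _ dst); last first.
  by move=> d e; rewrite !inE => /eqP dv /eqP ev; apply: dart_eqP; rewrite dv ev.
apply: eq_card => u; rewrite inE; apply/idP/imsetP => [vu|[d]].
  by exists (mkdart vu); rewrite ?inE /src /dst /=.
by rewrite inE => /eqP<- ->; exact: dart_adj.
Qed.

Lemma face_length_dart (f : face G) :
  face_length f = #|[set d : dart | left_face d == f]|.
Proof.
rewrite /face_length -(card_imset _ val_inj).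
apply: eq_card => u; rewrite inE; apply/andP/imsetP => [[vu uf]|[d]].
  by exists (Sub u vu); rewrite ?inE.
by rewrite inE => uf ->; split=> //; exact: dart_adj.
Qed.

(** An edge comes from at most one dart and its reverse. *)
Lemma card_dart_le : #|dart| <= 2 * #|edges G|.
Proof.
have -> : #|dart| = \sum_(d : dart) 1 by rewrite sum1_card.
rewrite (partition_big (fun d : dart => [set src d; dst d]) (fun e => e \in edges G)) /=.
  rewrite mulnC -sum_nat_const; apply: leq_sum => e _; rewrite sum1dep_card.
  case: (set_0Vmem [set d : dart | [set src d; dst d] == e]) => [->|[d]].
    by rewrite cards0.
  rewrite inE => /eqP <-; apply: (@leq_trans #|[set d; drev d]|); last first.
    by rewrite cards2; case: (_ == _).
  apply: subset_leq_card; apply/subsetP => c; rewrite !inE => /eqP E.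
  have: (src c \in [set src d; dst d]) && (dst c \in [set src d; dst d]).
    by rewrite -E !inE !eqxx orbT.
  rewrite !inE => /andP[].
  have := dart_adj c => cc.
  move=> /orP[/eqP c1|/eqP c1] /orP[/eqP c2|/eqP c2].
  - by rewrite c1 c2 adj_irr in cc.
  - by apply/orP; left; apply/eqP; apply: dart_eqP.
  - by apply/orP; right; apply/eqP; apply: dart_eqP.
  - by rewrite c1 c2 adj_irr in cc.
by move=> d _; apply/imset2P; exists (src d) (dst d); rewrite ?inE ?dart_adj.
Qed.

Definition walk (d : dart) (i : nat) : G := src (iter i dnext d).

Arguments walk : simpl never.

Lemma dst_iter (d : dart) i : dst (iter i dnext d) = walk d i.+1.
Proof. by []. Qed.

Lemma walk_adj (d : dart) i : adj (walk d i) (walk d i.+1).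
Proof. by rewrite -dst_iter dart_adj. Qed.

Lemma walk_neq1 (d : dart) i : walk d i != walk d i.+1.
Proof. by apply: contraTneq (walk_adj d i) => ->; rewrite adj_irr. Qed.

Lemma walk_rot (d : dart) i : walk d i.+2 = Defs.rot (walk d i.+1) (walk d i).
Proof. by []. Qed.

(** * Facial walks and short faces under minimum degree 3 *)

Section MinDegree.
Hypothesis deg_ge3 : forall v : G, 3 <= deg v.

(** Otherwise the cyclic order around [v] would consist of [x] and [rot v x] only. *)
Lemma rot_rot_neq (v x : G) : adj v x -> Defs.rot v (Defs.rot v x) != x.
Proof.
move=> vx; apply/negP => /eqP rx.
suff: deg v <= #|[set x; Defs.rot v x]|.
  by have := deg_ge3 v; rewrite cards2; case: (_ != _); lia.
apply: subset_leq_card; apply/subsetP => y; rewrite inE => vy.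
have /iter_findex <- := rot_cyclic vx vy.
elim: (findex _ _ _) => [|n]; first by rewrite !inE eqxx.
by rewrite iterS !inE => /orP[/eqP->|/eqP->]; rewrite ?rx eqxx ?orbT.
Qed.

Lemma rot_neq (v x : G) : adj v x -> Defs.rot v x != x.
Proof. by move=> vx; apply/negP => /eqP rx; have := rot_rot_neq vx; rewrite !rx eqxx. Qed.

Lemma walk_neq2 (d : dart) i : walk d i != walk d i.+2.
Proof. by rewrite walk_rot eq_sym rot_neq // adj_sym walk_adj. Qed.

Lemma order_ge3 (d : dart) : 3 <= order dnext d.
Proof.
have := iter_order dnext_inj d; have := order_gt0 dnext d.
case: (order _ _) => [|[|[|n]]] // _ E.
  by have := walk_neq1 d 0; rewrite /walk E eqxx.
by have := walk_neq2 d 0; rewrite /walk E eqxx.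
Qed.

Lemma walk_order (d : dart) i : walk d (i + order dnext d) = walk d i.
Proof. by rewrite /walk iterD iter_order //; exact: dnext_inj. Qed.

Lemma order_card (d : dart) : order dnext d = #|[set e | fconnect dnext d e]|.
Proof. by rewrite cardsE. Qed.

Lemma orbit_sub_face (d : dart) :
  [set e | fconnect dnext d e] \subset [set e | left_face e == left_face d].
Proof.
apply/subsetP => e; rewrite !inE => /iter_findex <-.
by rewrite left_face_iter.
Qed.

Lemma order_le_length (d : dart) : order dnext d <= face_length (left_face d).
Proof.
rewrite face_length_dart order_card; exact: subset_leq_card (orbit_sub_face d).
Qed.

Lemma length_ge3 (d : dart) : 3 <= face_length (left_face d).
Proof. exact: leq_trans (order_ge3 d) (order_le_length d). Qed.

(** A face may carry several boundary walks, but each has at least 3 darts, so length at most 5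
    leaves room for only one. *)
Lemma short_face_orbit (d e : dart) :
  left_face e = left_face d -> face_length (left_face d) <= 5 ->
  fconnect dnext d e /\ order dnext d = face_length (left_face d).
Proof.
move=> ed lt5.
have oneorbit c : left_face c = left_face d -> fconnect dnext d c.
  move=> cd; apply: contraLR lt5 => ndc; rewrite -ltnNge.
  suff: order dnext d + order dnext c <= face_length (left_face d).
    by have := order_ge3 d; have := order_ge3 c; lia.
  rewrite !order_card -cardsUI face_length_dart.
  rewrite (_ : _ :&: _ = set0) ?cards0 ?addn0; last first.
    apply/setP => b; rewrite !inE; apply/andP => -[db cb].
    by case/negP: ndc; apply: connect_trans db _; rewrite fconnect_sym //; exact: dnext_inj.
  apply: subset_leq_card; rewrite subUset orbit_sub_face.
  by rewrite -cd orbit_sub_face.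
split; first exact: oneorbit.
apply/eqP; rewrite eqn_leq order_le_length face_length_dart order_card.
by apply: subset_leq_card; apply/subsetP => c; rewrite !inE => /eqP/oneorbit.
Qed.

Lemma short_face_iter (d e : dart) :
  left_face e = left_face d -> face_length (left_face d) <= 5 ->
  exists2 i, i < face_length (left_face d) & iter i dnext d = e.
Proof.
move=> ed lt5; have [de <-] := short_face_orbit ed lt5.
by exists (findex dnext d e); [exact: findex_max | exact: iter_findex].
Qed.

(** If the reverse lay on the same 3-walk, two vertices one or two steps apart would coincide. This
    supplies the distinctness required by [face_adj]. *)
Lemma left_face_rev_neq (d : dart) :
  face_length (left_face d) = 3 -> left_face (drev d) != left_face d.
Proof.
move=> l3; apply/negP => /eqP E.
have := short_face_iter E; rewrite l3 => -[//|i i3] Ei.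
have := congr1 src Ei; have {Ei} := congr1 dst Ei; rewrite /= !dst_iter.
case: i i3 => [|[|[|i]]] // _ E2 E1.
- by have := walk_neq1 d 0; rewrite E2 eqxx.
- by have := walk_neq2 d 0; rewrite E2 eqxx.
- by have := walk_neq1 d 1; rewrite {2}/walk E1 eqxx.
Qed.

Lemma triangle_neighbours (d e : dart) :
  left_face e = left_face d -> face_length (left_face d) = 3 ->
  [\/ e = d, e = dnext d | d = dnext e].
Proof.
move=> ed l3; have [|i] := short_face_iter ed; first by rewrite l3.
have [|_ o3] := short_face_orbit ed; first by rewrite l3.
rewrite l3 in o3 *; case: i => [|[|[|i]]] // _ <-; [exact: Or31|exact: Or32|].
by apply: Or33; rewrite -iterS -o3 iter_order //; exact: dnext_inj.
Qed.

(** On a closed walk of length 5, any two positions are cyclically at most two steps apart. *)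
Lemma pentagon_src_inj (d e : dart) :
  left_face e = left_face d -> face_length (left_face d) = 5 ->
  src e = src d -> e = d.
Proof.
move=> ed l5; have [|i] := short_face_iter ed; first by rewrite l5.
have [|_ o5] := short_face_orbit ed; first by rewrite l5.
have w5 : walk d 5 = walk d 0 by rewrite -[RHS]walk_order o5 l5.
rewrite l5; case: i => [|[|[|[|[|i]]]]] // _ <- E.
- by have := walk_neq1 d 0; rewrite /walk E eqxx.
- by have := walk_neq2 d 0; rewrite /walk E eqxx.
- by have := walk_neq2 d 3; rewrite w5 /walk E eqxx.
- by have := walk_neq1 d 4; rewrite w5 /walk E eqxx.
Qed.

(* Two edges of a triangle cannot lie on a common pentagon: their common vertex
   occurs only once on the pentagon, so it would have degree 2. *)
Lemma pentagon_triangle_inj (d e : dart) :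
  face_length (left_face d) = 5 -> left_face e = left_face d ->
  face_length (left_face (drev d)) = 3 ->
  left_face (drev e) = left_face (drev d) -> e = d.
Proof.
(* In [main] the reverses of [c] and [b] are consecutive on the triangle. Then [dnext b] and [c]
   leave the same vertex, hence coincide, and two rotations around it return to [dst c]. *)
suff main c b : face_length (left_face c) = 5 -> left_face b = left_face c ->
    drev b = dnext (drev c) -> False.
  move=> l5 ed l3 red; have [E|E|E] := triangle_neighbours red l3.
  - exact: (can_inj drevK).
  - by case: (main _ _ l5 ed E).
  - by case: (main e d _ _ E); rewrite ed.
move=> l5 bc E.
have bE : b = drev (dnext (drev c)) by rewrite -E drevK.
have /(congr1 dst) : dnext b = c.
  by apply: pentagon_src_inj l5 _; rewrite ?left_face_next // bE.
by rewrite bE => E2; have /eqP := rot_rot_neq (dart_adj c).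
Qed.

(** * Tracing facial walks from 3-vertices to paying vertices *)

Ltac walk_neq :=
  (* Vertices of a walk are told apart by lying one or two steps apart or by their degrees;
     4-vertices three steps apart need a separate argument. *)
  first [ exact: walk_neq1 | exact: walk_neq2
        | by rewrite eq_sym walk_neq1 | by rewrite eq_sym walk_neq2
        | by apply: deg_neq; repeat match goal with E : deg _ = _ |- _ => rewrite E end ].

Ltac walk_xpy :=
  apply: xpy_path_intro;
  [ rewrite /= ?in_cons ?in_nil ?orbF ?negb_or ?andbT;
    repeat (apply/andP; split);
    first [ done | walk_neq | exact: walk_adj | by rewrite adj_sym walk_adj | idtac ]
  | assumption | assumption
  | by rewrite /=; repeat match goal with E : deg _ = _ |- _ => rewrite E end ].

Definition face_pays (d : dart) : bool :=
  [&& deg (walk d 0) == 3, deg (walk d 1) == 4, deg (walk d 2) == 4,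
      deg (walk d 3) == 4, deg (walk d 4) == 4
    & 7 <= face_length (left_face d)].

(* The face walk of d first leaves the vertices of degree 4 at src e, after i of
   them; e points back along the walk.  For i = 4 the 3-vertex src d must be
   adjacent to src e, as (H6) demands. *)
Definition reaches (d : dart) (i : nat) (e : dart) : bool :=
  [&& deg (walk d 0) == 3, drev e == iter i dnext d,
      all (fun j => deg (walk d j) == 4) (iota 1 i), 5 <= deg (src e)
    & (i == 4) ==> adj (src e) (src d)].

Definition vertex_pays (e : dart) : bool :=
  [exists d : dart, exists i : 'I_5, reaches d i e].

(** Going back along the walk from [e], the first vertex of degree 3 is [src d]: a longer trace
    would have it as an internal vertex, of degree 4. *)
Lemma reaches_inj d d' i i' e : reaches d i e -> reaches d' i' e -> d = d'.
Proof.
wlog le : d d' i i' / i <= i' => [main|].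
  by case: (leqP i i') => [|/ltnW] le H H'; [|symmetry]; apply: main le _ _.
case/and5P=> /eqP d3 /eqP di _ _ _ /and5P[_ /eqP d'i /allP all4 _ _].
have {di d'i} E : d = iter (i' - i) dnext d'.
  by apply: (@iter_dnext_inj i); rewrite -iterD subnKC // -di.
case: (posnP (i' - i)) => [E0|gt0]; first by rewrite E E0.
have /all4/eqP : i' - i \in iota 1 i' by rewrite mem_iota; lia.
by rewrite /walk -E -[src d]/(walk d 0) d3.
Qed.

(** If the first vertex of degree other than 4 has degree 3, the walk between the two 3-vertices is
    an edge for (H4), or splits at an internal 4-vertex into the two paths of (H5). *)
Lemma reaches_exists d : deg (walk d 0) = 3 -> ~~ face_pays d ->
  [\/ H4 G, H5 G | exists e, [exists i : 'I_5, reaches d i e]].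
Proof.
move=> d0 npay.
have reach i : i < 5 -> all (fun j => deg (walk d j) == 4) (iota 1 i) ->
    5 <= deg (walk d i.+1) -> (i == 4) ==> adj (walk d i.+1) (walk d 0) ->
    [\/ H4 G, H5 G | exists e, [exists i : 'I_5, reaches d i e]].
  move=> i5 a4 g5 ad; apply: Or33; exists (drev (iter i dnext d)); apply/existsP.
  by exists (Ordinal i5); rewrite /reaches d0 drevK !eqxx a4 /=; apply/andP.
have degP (v : G) : [\/ deg v = 3, deg v = 4 | 5 <= deg v].
  have := deg_ge3 v; case: (deg v) => [|[|[|[|[|n]]]]] // _;
  by [apply: Or31|apply: Or32|apply: Or33].
have [d1|d1|g] := degP (walk d 1); last exact: (reach 0).
  by apply: Or31; exists (walk d 0), (walk d 1); rewrite walk_adj.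
have [d2|d2|g] := degP (walk d 2); last by apply: (reach 1) => //=; rewrite d1.
  apply: Or32; apply: (@H5_intro _ (walk d 1) [::] (walk d 0) [::] (walk d 2)) => //=;
    by [walk_xpy|walk_neq].
have [d3|d3|g] := degP (walk d 3); last by apply: (reach 2) => //=; rewrite d1 d2.
  apply: Or32; apply: (@H5_intro _ (walk d 1) [::] (walk d 0) [:: walk d 2] (walk d 3)) => //=;
    by [walk_xpy|walk_neq].
have [d4|d4|g] := degP (walk d 4); last by apply: (reach 3) => //=; rewrite d1 d2 d3.
  apply: Or32; apply: (@H5_intro _ (walk d 2) [:: walk d 1] (walk d 0) [:: walk d 3] (walk d 4)) => //=;
    by [walk_xpy|walk_neq].
(* Now [walk d 1] to [walk d 4] have degree 4, so the face fails to pay only because its length is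
   at most 6. *)
have {npay} : order dnext d <= 6.
  apply: leq_trans (order_le_length d) _.
  by move: npay; rewrite /face_pays d0 d1 d2 d3 d4 /= -ltnNge.
have := order_ge3 d; have := walk_order d 1; have := walk_order d 0.
case: (order dnext d) => [|[|[|[|[|[|[|o]]]]]]] //; rewrite add0n add1n => w0 w1 _ _.
(* Periods 3 and 4 would give the 3-vertex degree 4. *)
- by move: d0; rewrite -w0 d3.
- by move: d0; rewrite -w0 d4.
(* Period 5: both paths of (H5) start at [walk d 1] and go around the face in opposite directions to
   the same 3-vertex. *)
- have n14 : walk d 4 != walk d 1 by rewrite -w1 walk_neq2.
  have d5 : deg (walk d 5) = 3 by rewrite w0.
  apply: Or32; apply: (@H5_intro _ (walk d 1) [::] (walk d 0)
    [:: walk d 2; walk d 3; walk d 4] (walk d 5)) => //=;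
  by [walk_xpy; rewrite eq_sym|walk_neq].
(* Period 6: [walk d 5] is the last vertex before the return, hence adjacent to [walk d 0]. *)
have d6 : deg (walk d 6) = 3 by rewrite w0.
have [d5|d5|g] := degP (walk d 5).
- by apply: Or31; exists (walk d 5), (walk d 6); rewrite walk_adj.
- apply: Or32; apply: (@H5_intro _ (walk d 3) [:: walk d 2; walk d 1] (walk d 0)
    [:: walk d 4; walk d 5] (walk d 6)) => //=; by [walk_xpy|walk_neq].
- by apply: (reach 4) => //=; rewrite ?d1 ?d2 ?d3 ?d4 // -w0 walk_adj.
Qed.

(** The trace is reversed, so that [e] is the first edge of the path. The path may be shorter than
    the trace, hence [size qw.1] in place of [i]. *)
Lemma reaches_path d (i : 'I_5) e : reaches d i e -> deg (src e) = 5 ->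
  exists qw : seq G * G,
    [/\ xpy_path 5 (size qw.1) 3 (src e) qw.1 qw.2, size qw.1 <= 4,
        second_vertex qw.1 qw.2 = dst e & size qw.1 = 4 -> adj (src e) qw.2].
Proof.
case/and5P=> /eqP d0 /eqP di /allP all4 _ ad.
have se : src e = walk d i.+1 by rewrite -dst_iter -di.
rewrite {}se in ad *.
have -> : dst e = walk d i by rewrite /walk -di.
have {}all4 j : 0 < j <= i -> deg (walk d j) = 4.
  by move=> ji; apply/eqP/all4; rewrite mem_iota; lia.
have {}ad : i = 4 :> nat -> adj (walk d i.+1) (walk d 0).
  by move=> i4; move: ad; rewrite {1}i4.
move: all4 ad; case: i {di} => [[|[|[|[|[|i]]]]] i5] //= all4 ad d5.
- exists ([::], walk d 0); split=> //; walk_xpy.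
- have d1 := all4 1 isT.
  exists ([:: walk d 1], walk d 0); split=> //; walk_xpy.
- have d1 := all4 1 isT; have d2 := all4 2 isT.
  exists ([:: walk d 2; walk d 1], walk d 0); split=> //; walk_xpy.
- have d1 := all4 1 isT; have d2 := all4 2 isT; have d3 := all4 3 isT.
  exists ([:: walk d 3; walk d 2; walk d 1], walk d 0); split=> //; walk_xpy.
have d1 := all4 1 isT; have d2 := all4 2 isT; have d3 := all4 3 isT.
(* [walk d 4] and [walk d 1] may coincide; the detour between them is then cut out. *)
have d4 := all4 4 isT; have [E|n41] := eqVneq (walk d 4) (walk d 1).
  exists ([:: walk d 4], walk d 0); split=> //.
  have a40 : adj (walk d 4) (walk d 0) by rewrite E adj_sym walk_adj.
  by walk_xpy.
exists ([:: walk d 4; walk d 3; walk d 2; walk d 1], walk d 0).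
by split=> //; walk_xpy.
Qed.

(* A path with four internal vertices needs the edge to its last vertex among the
   four chosen paths; that path has no internal vertex, so the first four paths
   are admissible once those with four internal vertices are listed last. *)
Lemma H6_intro (v : G) : deg v = 5 ->
  4 <= #|[set e | (src e == v) && vertex_pays e]| -> H6 G.
Proof.
move=> v5; set S := [set e | _] => S4.
pose good (e : dart) (qw : seq G * G) :=
  [/\ xpy_path 5 (size qw.1) 3 v qw.1 qw.2, size qw.1 <= 4,
      second_vertex qw.1 qw.2 = dst e & size qw.1 = 4 -> adj v qw.2].
have /fin_all_exists[F FP] : forall e : dart, exists qw, e \in S -> good e qw.
  move=> e; case: (boolP (e \in S)) => [|_]; last by exists ([::], v).
  rewrite inE => /andP[/eqP ev /existsP[d /existsP[i re]]].
  have [|qw] := reaches_path re; first by rewrite ev.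
  by rewrite ev => H; exists qw.
pose long e := size (F e).1 == 4.
have [E [uE ES sE]] : exists E : seq dart, [/\ uniq E, E =i S & size E = #|S|].
  by exists (enum S); rewrite enum_uniq -cardE; split=> // e; rewrite mem_enum.
pose A := [seq e <- E | ~~ long e]; pose B := [seq e <- E | long e].
pose L := take 4 (A ++ B).
have sL : size L = 4.
  by rewrite size_takel // size_cat !size_filter addnC count_predC sE.
have uL : uniq L.
  apply: take_uniq; rewrite cat_uniq !filter_uniq //= andbT.
  by apply/hasPn => e; rewrite !mem_filter => /andP[-> _].
have LS e : e \in L -> e \in S.
  by move/mem_take; rewrite mem_cat !mem_filter ES => /orP[] /andP[].
have [e0 e0S] : exists e0, e0 \in S by apply/card_gt0P; lia.
have nS (i : 'I_4) : nth e0 L i \in S by apply/LS/mem_nth; rewrite sL.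
exists v, (fun i : 'I_4 => size (F (nth e0 L i)).1),
  (fun i : 'I_4 => (F (nth e0 L i)).1), (fun i : 'I_4 => (F (nth e0 L i)).2).
split.
- by move=> i; have [] := FP _ (nS i).
- move=> i j /=; have [_ _ -> _] := FP _ (nS i); have [_ _ -> _] := FP _ (nS j).
  move=> dd; apply/ord_inj/eqP; rewrite -(nth_uniq e0 _ _ uL) ?sL //.
  apply/eqP/dart_eqP => //.
  by have := nS i; have := nS j; rewrite !inE => /andP[/eqP-> _] /andP[/eqP-> _].
move=> i pi4; set e := nth e0 L i in pi4 *.
have [[_ _ _ w3 _] _ _ /(_ pi4) vw] := FP e (nS i).
(* The edge from [v] to the 3-vertex ending the long path is itself a paying dart, with a trace
   without internal vertices. *)
split=> //; pose e' := mkdart vw.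
have e'S : e' \in S.
  rewrite inE eqxx /=; apply/existsP; exists (drev e'); apply/existsP; exists ord0.
  by rewrite /reaches /= [deg _]w3 !eqxx -[src e']/v v5.
have [[_ _ _ _ q4] _ snd _] := FP e' e'S.
(* A first internal vertex would be [dst e'], which has degree 3 and not 4. *)
have q0 : (F e').1 = [::].
  case: (F e').1 q4 snd => // y q /(_ y); rewrite inE eqxx => /(_ isT) + yw.
  by rewrite [y]yw [deg _]w3.
have e'L : e' \in L.
  have e'A : e' \in A by rewrite mem_filter /long q0 ES.
  have : e \in L by rewrite mem_nth ?sL.
  (* Since the long [e] was selected, the prefix extends past [A] and so contains all of [A]. *)
  rewrite /L take_cat; case: ifP => _.
    by move/mem_take; rewrite mem_filter /long pi4 eqxx.
  by move=> _; rewrite mem_cat e'A.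
have jL : index e' L < 4 by rewrite -sL index_mem.
exists (Ordinal jL); rewrite /= nth_index // q0; split=> //.
by move: snd; rewrite q0.
Qed.

(** A vertex pays at most once per dart, which [3 * deg v - 12] covers from degree 6 on. At degree 5
    it covers three payments, and a fourth gives (H6). A 3-vertex has deficit 3 and receives 3. *)
Lemma vertex_charge (v : G) : H6 G \/
  12 + #|[set e | (src e == v) && vertex_pays e]| <=
  3 * deg v + #|[set d : dart | (src d == v) && (deg (src d) == 3)]|.
Proof.
set S := [set e | _].
have SD : #|S| <= deg v.
  rewrite deg_dart; apply: subset_leq_card; apply/subsetP => e.
  by rewrite !inE => /andP[].
case: (posnP #|S|) => [S0|/card_gt0P[e]].
  right; case: (ltnP 3 (deg v)) => [|v3]; first by lia.
  have {}v3 : deg v = 3 by have := deg_ge3 v; lia.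
  rewrite S0; suff -> : #|[set d | (src d == v) && (deg (src d) == 3)]| = deg v.
    by rewrite v3.
  rewrite deg_dart; apply: eq_card => d.
  by rewrite !inE; case: eqP => //= ->; rewrite v3.
rewrite inE => /andP[/eqP ev /existsP[d /existsP[i /and5P[_ _ _ v5 _]]]].
rewrite ev in v5; case: (ltnP 3 #|S|) => [S4|]; last by right; lia.
have [v5'|] := eqVneq (deg v) 5; first by left; exact: H6_intro v5' S4.
by right; lia.
Qed.

(** * Charge balance of the faces *)

Hypothesis tri_adj : forall f g : face G,
  face_length f = 3 -> face_adj f g -> 5 <= face_length g.
Hypothesis penta_adj : forall f : face G, face_length f = 5 ->
  #|[set g : face G | face_adj f g && (face_length g == 3)]| <= 3.

Lemma face_adj_rev (d : dart) : left_face d != left_face (drev d) ->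
  face_adj (left_face d) (left_face (drev d)).
Proof.
move=> neq; rewrite /face_adj neq; apply/existsP; exists (src d).
by apply/existsP; exists (dst d); rewrite dart_adj !eqxx.
Qed.

Lemma triangle_rev_length (d : dart) :
  face_length (left_face d) = 3 -> 5 <= face_length (left_face (drev d)).
Proof.
move=> l3; apply: (tri_adj l3); apply: face_adj_rev.
by rewrite eq_sym left_face_rev_neq.
Qed.

(** A paid dart leaves a 3-vertex and is followed by two darts leaving 4-vertices, so these triples
    of darts are disjoint. *)
Lemma face_pays_bound (f : face G) :
  3 * #|[set d | (left_face d == f) && face_pays d]| <= face_length f.
Proof.
set A := [set d | _]; rewrite face_length_dart.
have disj : A :&: dnext @: A = set0.
  apply/setP => d; rewrite !inE; apply/negP => /andP[/andP[_ /and5P[/eqP d3 _ _ _ _]]].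
  case/imsetP => e; rewrite inE => /andP[_ /and5P[_ /eqP e4 _ _ _]] E.
  by move: d3; rewrite E -[walk _ _]/(walk e 1) e4.
have disj2 : A :&: dnext @: (dnext @: A) = set0.
  apply/setP => d; rewrite !inE; apply/negP => /andP[/andP[_ /and5P[/eqP d3 _ _ _ _]]].
  case/imsetP => _ /imsetP[e + ->]; rewrite inE => /andP[_ /and5P[_ _ /eqP e4 _ _]] E.
  by move: d3; rewrite E -[walk _ _]/(walk e 2) e4.
have cA (B : {set dart}) : #|dnext @: B| = #|B| by apply: card_imset; exact: dnext_inj.
have := cardsUI (A :|: dnext @: A) (dnext @: (dnext @: A)).
have := cardsUI A (dnext @: A).
rewrite setIUl disj disj2 set0U -imsetI; last by move=> ? ? _ _; exact: dnext_inj.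
rewrite disj imset0 cards0 !cA => c1 c2.
suff : #|A :|: dnext @: A :|: dnext @: (dnext @: A)| <= #|[set d | left_face d == f]|.
  by lia.
apply: subset_leq_card; apply/subsetP => d; rewrite !inE.
case/orP => [/orP[/andP[]//|]|].
  by case/imsetP => e; rewrite inE => /andP[ef _] ->; rewrite left_face_next.
by case/imsetP => _ /imsetP[e + ->]; rewrite inE => /andP[ef _] ->; rewrite !left_face_next.
Qed.

(** Connectedness of the incidence graph gives a vertex on [f], and this vertex is not isolated. *)
Lemma face_dart (v : G) (f : face G) : exists d, left_face d = f.
Proof.
have /connectP[[|[u|g] p] //= /andP[+ _] _] := plane_connected (inr f) (inl v).
case/existsP => w /andP[/orP[uw|/andP[_ /eqP u0]] /eqP <-].
  by exists (mkdart uw).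
by have := deg_ge3 u; rewrite u0.
Qed.

(** A 3-face has deficit 3 and receives 3. A 4-face pays nothing, a 5-face at most 3, a 6-face at
    most 6. From length 7 on, [3 * face_length f - 12] covers one unit per edge plus a third of the
    length, rounded down. *)
Lemma face_charge (v : G) (f : face G) :
  12 + #|[set d | (left_face d == f) && (face_length (left_face (drev d)) == 3)]|
     + #|[set d | (left_face d == f) && face_pays d]| <=
  3 * face_length f
     + #|[set d | (left_face d == f) && (face_length (left_face d) == 3)]|.
Proof.
set A := [set d | _]; set P := [set d | _ && face_pays d]; set T := [set d | _].
have P3 : 3 * #|P| <= face_length f := face_pays_bound f.
have P0 : face_length f < 7 -> #|P| = 0.
  move=> l7; apply: eq_card0 => d; rewrite !inE; apply/negP.
  by case/andP=> /eqP df /and5P[_ _ _ _ /andP[_]]; rewrite df; lia.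
have Af : #|A| <= face_length f.
  rewrite face_length_dart; apply: subset_leq_card; apply/subsetP => e.
  by rewrite !inE => /andP[].
have A0 : face_length f < 5 -> #|A| = 0.
  move=> l5; apply: eq_card0 => d; rewrite !inE; apply/negP => /andP[/eqP df /eqP l3].
  by have := triangle_rev_length l3; rewrite drevK df; lia.
have A5 : face_length f = 5 -> #|A| <= 3.
  move=> l5; apply: leq_trans (penta_adj l5).
  (* The hypothesis counts 3-faces while [A] counts edges; on a pentagon distinct such edges lead to
     distinct 3-faces. *)
  rewrite -(@card_in_imset _ _ (fun d => left_face (drev d)) A); last first.
    move=> d e; rewrite !inE => /andP[/eqP df _] /andP[/eqP ef /eqP e3] E.
    by apply: pentagon_triangle_inj => //; rewrite ?ef ?df.
  apply: subset_leq_card; apply/subsetP => g /imsetP[d].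
  rewrite !inE => /andP[/eqP df l3] ->; rewrite l3 andbT -df; apply: face_adj_rev.
  by apply: contraTneq l3 => <-; rewrite df l5.
have T3 : face_length f = 3 -> #|T| = 3.
  move=> l3; rewrite -[RHS]l3 face_length_dart; apply: eq_card => d.
  by rewrite !inE; case: eqP => //= ->; rewrite l3.
have f3 : 3 <= face_length f by have [d <-] := face_dart v f; exact: length_ge3.
case: (ltnP (face_length f) 7) => [l7|l7]; last by lia.
rewrite P0 //; case: (ltnP (face_length f) 5) => [l5|l5].
  rewrite A0 //; have [/T3->|] := eqVneq (face_length f) 3; lia.
by have [/A5|] := eqVneq (face_length f) 5; lia.
Qed.

(** Each dart at a 3-vertex not paid by its face is sent to a dart it reaches; this choice is
    injective by [reaches_inj]. *)
Lemma card_dart_deg3 :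
  [\/ H4 G, H5 G
    | #|[set d : dart | deg (src d) == 3]| <=
      #|[set d | face_pays d]| + #|[set e | vertex_pays e]|].
Proof.
set D := [set d | _]; set P := [set d | face_pays d].
case: (boolP [forall d in D :\: P, exists e, exists i : 'I_5, reaches d i e]) => [|]; last first.
  rewrite negb_forall_in => /exists_inP[d]; rewrite !inE => /andP[np /eqP d3] ne.
  have [?|?|[e He]] := reaches_exists d3 np; [exact: Or31 | exact: Or32 | ].
  by case/existsP: ne; exists e.
move=> /forall_inP DP; apply: Or33.
have /fin_all_exists[F FP] : forall d : dart, exists e,
    d \in D :\: P -> [exists i : 'I_5, reaches d i e].
  move=> d; case: (boolP (d \in D :\: P)) => [/DP/existsP[e He]|_]; last by exists d.
  by exists e.
rewrite -(cardsID P D); apply: leq_add.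
  by apply: subset_leq_card; exact: subsetIr.
rewrite -(@card_in_imset _ _ F (D :\: P)); last first.
  move=> d e /FP/existsP[i di] /FP/existsP[j ej] E; rewrite -E in ej.
  exact: reaches_inj di ej.
apply: subset_leq_card; apply/subsetP => _ /imsetP[d /FP Fd ->].
by rewrite inE; apply/existsP; exists d.
Qed.

End MinDegree.
End Darts.

(** * Summation of the charges *)

Theorem theorem8 (G : plane_graph)
    (h3 : forall f g : face G,
        face_length f = 3 -> face_adj f g -> 5 <= face_length g)
    (h5 : forall f : face G, face_length f = 5 ->
        #|[set g : face G | face_adj f g && (face_length g == 3)]| <= 3)
    (hdelta : 3 <= min_deg G) :
  H4 G \/ H5 G \/ H6 G.
Proof.
have deg_ge3 (v : G) : 3 <= deg v := leq_trans hdelta (min_deg_le v).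
(* The minimum degree is bounded by the number of vertices, so the graph is not empty. *)
have [v0 _] : exists v0 : G, v0 \in G.
  by apply/card_gt0P; apply: leq_trans (min_deg_le_card G); exact: leq_trans hdelta.
have [H|H|D3] := card_dart_deg3 deg_ge3; [by left | by right; left | right; right].
pose paid (v : G) := #|[set e : dart G | (src e == v) && vertex_pays e]|.
pose got (v : G) := #|[set d : dart G | (src d == v) && (deg (src d) == 3)]|.
case: (boolP [forall v : G, 12 + paid v <= 3 * deg v + got v]) => [/forallP vch|]; last first.
  by case/forallPn => v vch; have [//|] := vertex_charge deg_ge3 v; rewrite (negPf vch).
have Sv : \sum_(v : G) (12 + paid v) <= \sum_(v : G) (3 * deg v + got v).
  by apply: leq_sum => v _; exact: vch.
have Sf := leq_sum (index_enum (face G)) (P := xpredT)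
  (fun f _ => face_charge deg_ge3 h3 h5 v0 f).
have Sdeg : \sum_(v : G) deg v = #|dart G|.
  rewrite -cardsT -(sum_card_fiber xpredT (@src G)).
  by apply: eq_bigr => v _; rewrite deg_dart; apply: eq_card => d; rewrite !inE andbT.
have Slen : \sum_(f : face G) face_length f = #|dart G|.
  rewrite -cardsT -(sum_card_fiber xpredT (@left_face G)).
  by apply: eq_bigr => f _; rewrite face_length_dart; apply: eq_card => d; rewrite !inE andbT.
(* What faces send across edges equals what the 3-faces receive, by reversing darts. *)
have rev3 : #|[set d : dart G | face_length (left_face (drev d)) == 3]| =
            #|[set d : dart G | face_length (left_face d) == 3]|.
  rewrite -(card_imset _ (can_inj (@drevK G))); apply: eq_card => d.
  apply/imsetP/idP => [[e]|]; rewrite !inE; first by move=> e3 ->.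
  by move=> d3; exists (drev d); rewrite ?inE drevK.
have sumc (I : finType) n : \sum_(i : I) n = #|I| * n by rewrite sum_nat_const.
move: Sv Sf; rewrite !big_split /= !sum_card_fiber !sumc.
rewrite Sdeg Slen rev3.
(* The sums give [12 * (#|G| + #|face G|) <= 6 * #|dart G| <= 12 * #|edges G|], against Euler's
   formula. *)
have := plane_Euler G; have := card_dart_le G; lia.
Qed.
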